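(* Let $f,g_1,\dots,g_m:\mathbb R^n\to\mathbb R$ be convex with $\mathcal S^\star\ne\emptyset$, let $\eta>0$, and let $z^k=(x^k,y^k)$ be generated from $z^0\in\mathbb R^{n+m}$ by the proximal point method $$(x^{k+1},y^{k+1})=\arg\min_{x\in\mathbb R^n}\max_{y\in\mathbb R^m_+}\ f(x)+\langle y,G(x)\rangle+\frac1{2\eta}\|x-x^k\|_2^2-\frac1{2\eta}\|y-y^k\|_2^2,$$ with auxiliary iterates $\tilde z^k=z^k$. Put $P=\eta^{-1}I$ and $\gamma=1$. Then: 1. For every $z^0$ there is $z^\star\in\mathcal S^\star$ with $\max\{\|z^k-z^\star\|_P,\|\tilde z^k-z^\star\|_P\}\to0$; there is a dual stepsize $\hat\eta>0$ with $y^{k+1}=\operatorname{proj}_{\mathbb R^m_+}(y^k+\hat\eta\,G(\tilde x^{k+1}))$ for all $k\ge 0$; and for every $t>0$ and $j\in[m]$ there are $L^x_{tj},L^y_{tj}>0$ such that $g_j(x)-g_j(x')\le L^x_{tj}\|z-z'\|_P$ and $|y_j-y_j'|\le L^y_{tj}\|z-z'\|_P$ for all $z=(x,y),z'=(x',y')\in\mathbf B^P_t(z^\star)$. 2. For every $z^0$, $\operatorname{dist}_{P^{-1}}(0,\mathcal F(z^k))\le\gamma\operatorname{dist}_P(z^0,\mathcal S^\star)/\sqrt k$ for all $k\ge1$, and there is $\tau>0$ with $\operatorname{dist}_2(z^k,\mathcal S^\star)\le\tau$ for all $k\ge1$. 3. For every $z^0$, $\max\{\|z^{k+1}-z^k\|_P,\|z^k-\tilde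 z^k\|_P\}\le\gamma\operatorname{dist}_P(z^0,\mathcal S^\star)/\sqrt k$ for all $k\ge1$, and $\|z^\star-\underline z\|_P\le\|z^k-\underline z\|_P$ for all $\underline z\in\mathcal S^\star$ and all $k\ge0$.
   Context: $G(x)=(g_1(x),\dots,g_m(x))$; $h(y)=\inf_{x\in\mathbb R^n}\{f(x)+\langle y,G(x)\rangle\}$; $\mathcal S^\star$ is the set of primal-dual solutions of $\min f$ s.t. $G\le0$: all $(x,y)\in\mathbb R^n\times\mathbb R^m$ with $f(x)-h(y)\le0$, $G(x)\le0$, $y\ge0$. The saddle subdifferential of $\mathcal L(x,y)=f(x)-\iota_{\mathbb R^m_+}(y)+\langle y,G(x)\rangle$ is $\mathcal F(z)=\partial_x\mathcal L(x,y)\times\partial_y(-\mathcal L)(x,y)$, i.e. $\mathcal F(x,y)=\big(\partial f(x)+\sum_j y_j\partial g_j(x)\big)\times\big(-G(x)+N_{\mathbb R^m_+}(y)\big)$ if $y\ge0$ and $\emptyset$ otherwise ($N_{\mathbb R^m_+}$ is the normal cone). For positive definite $M$, $\|z\|_M=\sqrt{z^\top Mz}$, $\operatorname{dist}_M(z,Q)=\inf_{q\in Q}\|z-q\|_M$; $\operatorname{dist}_2$ is Euclidean distance; $\mathbf B^P_t(z)$ is the open $\|\cdot\|_P$-ball of radius $t$ around $z$. *)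

(* Defs.v *)
From HB Require Import structures.
From mathcomp Require Import all_boot all_order all_algebra.
From mathcomp Require Import all_classical all_reals all_analysis.

Set Implicit Arguments.
Unset Strict Implicit.
Unset Printing Implicit Defensive.

Import Order.TTheory GRing.Theory Num.Theory.
Import numFieldNormedType.Exports.

Local Open Scope classical_set_scope.
Local Open Scope ring_scope.

Section Euclidean.
Context {R : realType}.

Definition dotv n (u v : 'cV[R]_n) : R := (u^T *m v) 0 0.

(* The norm of matrices provided by the library is the maximum norm. *)
Definition norm2 n (u : 'cV[R]_n) : R := Num.sqrt (dotv u u).

Definition normM n (M : 'M[R]_n) (z : 'cV[R]_n) : R :=
  Num.sqrt ((z^T *m M *m z) 0 0).

Definition ballM n (M : 'M[R]_n) (t : R) (z : 'cV[R]_n) : set 'cV[R]_n :=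
  [set w | normM M (w - z) < t].

(* The distance to the empty set is +oo. *)
Definition dist n (N : 'cV[R]_n -> R) (z : 'cV[R]_n) (Q : set 'cV[R]_n) : \bar R :=
  ereal_inf [set (N (z - q))%:E | q in Q].

Definition distM n (M : 'M[R]_n) := dist (normM M).
Definition dist2 n := dist (@norm2 n).

Definition nonneg_orthant {m} : set 'cV[R]_m := [set y | forall j, 0 <= y j 0].

Definition is_proj n (D : set 'cV[R]_n) (v p : 'cV[R]_n) : Prop :=
  D p /\ forall q, D q -> norm2 (v - p) <= norm2 (v - q).

Definition convex_fun n (f : 'cV[R]_n -> R) : Prop :=
  convex_function [set: convex_lmodType 'cV[R]_n] f.

(* Convex subdifferential; empty wherever phi is infinite. *)
Definition subdiff n (phi : 'cV[R]_n -> \bar R) (x : 'cV[R]_n) : set 'cV[R]_n :=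
  [set v | phi x \is a fin_num /\
           forall x', (phi x + (dotv v (x' - x))%:E <= phi x')%E].

(* x minimizes x' |-> sup_(y' in D) phi x' y', and y attains the maximum at x. *)
Definition is_argminmax n m (D : set 'cV[R]_m)
    (phi : 'cV[R]_n -> 'cV[R]_m -> R) (x : 'cV[R]_n) (y : 'cV[R]_m) : Prop :=
  (forall x', ereal_sup [set (phi x y')%:E | y' in D]
              <= ereal_sup [set (phi x' y')%:E | y' in D])%E /\
  (D y /\ forall y', D y' -> phi x y' <= phi x y).

End Euclidean.

Section ConvexProgram.
Context {R : realType} {n m : nat}.
Variables (f : 'cV[R]_n -> R) (g : 'I_m -> 'cV[R]_n -> R).
Implicit Types (x : 'cV[R]_n) (y : 'cV[R]_m) (z : 'cV[R]_(n + m)).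

Definition Gmap x : 'cV[R]_m := \col_j g j x.

Definition dual_fun y : \bar R :=
  ereal_inf [set (f x + dotv y (Gmap x))%:E | x in [set: 'cV[R]_n]].

(* A pair (x, y) is encoded as the block vector z = col_mx x y. *)
Definition sol_set : set 'cV[R]_(n + m) :=
  [set z | let x := usubmx z in let y := dsubmx z in
    [/\ ((f x)%:E - dual_fun y <= 0)%E,
        (forall j, g j x <= 0) &
        nonneg_orthant y]].

Definition indicator_nonneg y : \bar R := if y \in nonneg_orthant then 0%E else +oo%E.

Definition lagrangian x y : \bar R :=
  ((f x)%:E - indicator_nonneg y + (dotv y (Gmap x))%:E)%E.

Definition saddle_subdiff z : set 'cV[R]_(n + m) :=
  let x := usubmx z in let y := dsubmx z in
  [set w | subdiff (fun x' => lagrangian x' y) x (usubmx w) /\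
           subdiff (fun y' => (- lagrangian x y')%E) y (dsubmx w)].

Definition ppm_objective (eta : R) (zk : 'cV[R]_(n + m)) x y : R :=
  f x + dotv y (Gmap x)
  + (2 * eta)^-1 * norm2 (x - usubmx zk) ^+ 2
  - (2 * eta)^-1 * norm2 (y - dsubmx zk) ^+ 2.

Definition ppm_iterates (eta : R) (z : nat -> 'cV[R]_(n + m)) : Prop :=
  forall k, is_argminmax nonneg_orthant (ppm_objective eta (z k))
              (usubmx (z k.+1)) (dsubmx (z k.+1)).

End ConvexProgram.

(* Main.v *)
Require Import Defs.
From mathcomp Require Import all_boot all_order all_algebra.
From mathcomp Require Import all_classical all_reals all_analysis.
From mathcomp Require Import ring lra.
Set Implicit Arguments.
Unset Strict Implicit.
Unset Printing Implicit Defensive.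
Import Order.TTheory GRing.Theory Num.Theory.
Import numFieldNormedType.Exports.
Local Open Scope classical_set_scope.
Local Open Scope ring_scope.

(** Write [L] for the finite Lagrangian [lag], [(x, y)] for the blocks of [z]
    and [c = (2 eta)^-1].  Everything rests on one inequality about a single
    proximal step from [z] to [z+] ([prox_inequality]): for every [w] with
    nonnegative dual block,

      [L x+ y_w - L x_w y+ + c (|z+ - z|^2 + |w - z+|^2 - |w - z|^2) <= 0].

    It adds two strong optimality conditions for the regularised function
    [phi].  The one in [y] ([step_dual]) is strong concavity at a maximiser.
    The one in [x] ([step_primal]) is of Danskin type, because [x+] minimises
    the supremum [sup_y phi x y] and not [phi x y+]; it says that the argminmax
    is a saddle point.  For its proof it suffices to move
    from [x+] a fraction [t] towards a competitor and to nearly attain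
    [phi x+ y+] there at some [y]: strong concavity absorbs, up to order [t^2],
    the effect of replacing [y+] by [y].  The same two conditions, read as
    subgradient inequalities, give [eta^-1 (z - z+)] in the saddle
    subdifferential at [z+], and the one in [y] is also the projection formula
    with dual stepsize [eta].

    Solutions are exactly the saddle points of [L] ([sol_set_saddle],
    [saddle_sol_set]).  With [w] a solution, the inequality gives
    [|z+ - z|^2 + |z+ - w|^2 <= |z - w|^2] ([fejer]): distances to solutions
    decrease and squared step lengths are summable.  With [w] the next or the
    previous iterate, two consecutive instances give that step lengths do not
    increase ([step_nonincreasing]); so the k-th step length is at most
    [dist (z 0, S) / sqrt k] ([step_rate]).

    For convergence, the iterates are bounded, hence have a limit [zbar] along
    some ultrafilter finer than [\oo] ([bounded_cluster]).  Finite convex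
    functions are Lipschitz on bounded sets ([convex_fun_lipschitz]), so one can
    pass to the limit in the proximal inequality and obtain that [zbar] is a
    saddle point ([iterates_cluster]).  Since distances to [zbar] decrease,
    convergence along the ultrafilter is convergence of the whole sequence
    ([iterates_cvg]). *)

(** * Euclidean inner product *)

Section InnerProduct.
Context {R : realType}.
Implicit Types n m : nat.

Lemma dotvE n (u v : 'cV[R]_n) : dotv u v = \sum_i u i 0 * v i 0.
Proof. by rewrite /dotv mxE; apply: eq_bigr => i _; rewrite mxE. Qed.

Lemma dotvC n (u v : 'cV[R]_n) : dotv u v = dotv v u.
Proof. by rewrite !dotvE; apply: eq_bigr => i _; rewrite mulrC. Qed.

Lemma dotvDl n (u v w : 'cV[R]_n) : dotv (u + v) w = dotv u w + dotv v w.
Proof. by rewrite /dotv linearD mulmxDl mxE. Qed.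

Lemma dotvNl n (u w : 'cV[R]_n) : dotv (- u) w = - dotv u w.
Proof. by rewrite /dotv linearN mulNmx mxE. Qed.

Lemma dotvZl n (a : R) (u w : 'cV[R]_n) : dotv (a *: u) w = a * dotv u w.
Proof. by rewrite /dotv linearZ -scalemxAl mxE. Qed.

Lemma dotvDr n (u v w : 'cV[R]_n) : dotv w (u + v) = dotv w u + dotv w v.
Proof. by rewrite dotvC dotvDl !(dotvC w). Qed.

Lemma dotvNr n (u w : 'cV[R]_n) : dotv w (- u) = - dotv w u.
Proof. by rewrite dotvC dotvNl (dotvC w). Qed.

Lemma dotvZr n (a : R) (u w : 'cV[R]_n) : dotv w (a *: u) = a * dotv w u.
Proof. by rewrite dotvC dotvZl (dotvC w). Qed.

Definition dotv_lin := (dotvDl, dotvDr, dotvNl, dotvNr, dotvZl, dotvZr).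

Lemma dotv0l n (w : 'cV[R]_n) : dotv 0 w = 0.
Proof. by rewrite -(scale0r 0) dotvZl mul0r. Qed.

Lemma dotv_ge0 n (u : 'cV[R]_n) : 0 <= dotv u u.
Proof. by rewrite dotvE sumr_ge0 // => i _; rewrite -expr2 sqr_ge0. Qed.

Lemma norm2_sqr n (u : 'cV[R]_n) : norm2 u ^+ 2 = dotv u u.
Proof. exact/sqr_sqrtr/dotv_ge0. Qed.

Lemma norm2_ge0 n (u : 'cV[R]_n) : 0 <= norm2 u.
Proof. exact: sqrtr_ge0. Qed.

Lemma dotv_block n m (z w : 'cV[R]_(n + m)) :
  dotv z w = dotv (usubmx z) (usubmx w) + dotv (dsubmx z) (dsubmx w).
Proof. by rewrite -{1}[z]vsubmxK -{1}[w]vsubmxK /dotv tr_col_mx mul_row_col mxE. Qed.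

Lemma normM_scalar n (a : R) (z : 'cV[R]_n) :
  0 <= a -> normM a%:M z = Num.sqrt a * norm2 z.
Proof. by move=> a0; rewrite /normM mul_mx_scalar -scalemxAl mxE sqrtrM. Qed.

Lemma dotv_coord_le n (u : 'cV[R]_n) i : u i 0 ^+ 2 <= dotv u u.
Proof.
rewrite dotvE (bigD1 i) //= -expr2 lerDl sumr_ge0 // => j _.
by rewrite -expr2 sqr_ge0.
Qed.

Lemma coord_le_norm2 n (u : 'cV[R]_n) i : `|u i 0| <= norm2 u.
Proof. by rewrite -sqrtr_sqr ler_wsqrtr // dotv_coord_le. Qed.

Lemma norm2_usubmx n m (z : 'cV[R]_(n + m)) : norm2 (usubmx z) <= norm2 z.
Proof. by rewrite ler_wsqrtr // [leRHS]dotv_block lerDl dotv_ge0. Qed.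

Lemma norm2_dsubmx n m (z : 'cV[R]_(n + m)) : norm2 (dsubmx z) <= norm2 z.
Proof. by rewrite ler_wsqrtr // [leRHS]dotv_block lerDr dotv_ge0. Qed.

End InnerProduct.

(** * Lipschitz continuity of finite convex functions *)

Section ConvexLipschitz.
Context {R : realType} {n : nat}.
Implicit Types (f : 'cV[R]_n -> R) (x u v : 'cV[R]_n).

Lemma norm_le_norm2 x : `|x| <= norm2 x.
Proof.
have [->|x0] := eqVneq x 0; first by rewrite normr0 norm2_ge0.
have /mx_norm_neq0[[i j] /=] : mx_norm x != 0 by rewrite -[mx_norm x]/`|x| normr_eq0.
rewrite (ord1 j) => e; rewrite [leLHS]e.
exact: coord_le_norm2.
Qed.

Lemma coord_le_norm x i : `|x i 0| <= `|x|.
Proof.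
rewrite [leRHS]mx_normrE.
exact: (le_bigmax _ (fun ij : 'I_n * 'I_1 => `|x ij.1 ij.2|) (i, 0)).
Qed.

Lemma convex_funE f (t : R) u v : convex_fun f -> 0 <= t -> t <= 1 ->
  f (t *: u + (1 - t) *: v) <= t * f u + (1 - t) * f v.
Proof.
move=> cf t0 t1; have t01 : t \in `[0, 1]%R by rewrite in_itv /= t0 t1.
have := cf (Itv01 t0 t1) u v; rewrite !in_setT => /(_ isT isT).
by rewrite convRE.
Qed.

(** Jensen's inequality at weight one half, scaled so that it bounds [f] at a
    plain sum; this is what makes an induction over coordinates possible. *)
Lemma convex_fun_midpoint f u v : convex_fun f ->
  f (u + v) <= 2^-1 * (f (2 *: u) + f (2 *: v)).
Proof.
move=> cf; have h1 : (0 : R) <= 2^-1 by lra.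
have h2 : (2^-1 : R) <= 1 by lra.
have := convex_funE (2 *: u) (2 *: v) cf h1 h2.
rewrite (_ : 1 - 2^-1 = 2^-1 :> R); last by field.
by rewrite !scalerA mulVf ?pnatr_eq0 // !scale1r mulrDr.
Qed.

Lemma convex_fun_axis f (r t : R) (e : 'cV[R]_n) : convex_fun f -> `|t| <= r ->
  f (t *: e) <= Num.max (f (r *: e)) (f (- r *: e)).
Proof.
move=> cf tr; have r0 : 0 <= r by exact: le_trans tr.
move: r0; rewrite le_eqVlt => /predU1P[r0|r0].
  by move: tr; rewrite -r0 normr_le0 => /eqP ->; rewrite le_max lexx.
move: tr; rewrite ler_norml => /andP[t1 t2].
have s0 : 0 <= (t + r) / (2 * r) by rewrite divr_ge0 //; lra.
have s1 : (t + r) / (2 * r) <= 1 by rewrite ler_pdivrMr; lra.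
have := convex_funE (r *: e) (- r *: e) cf s0 s1; set s := _ / _ in s0 s1 *.
rewrite !scalerA -scalerDl (_ : s * r + (1 - s) * - r = t); last first.
  by rewrite /s; field; rewrite gt_eqF.
move=> /le_trans; apply.
set M := Num.max _ _.
have a1 : f (r *: e) <= M by rewrite le_max lexx.
have a2 : f (- r *: e) <= M by rewrite le_max lexx orbT.
nra.
Qed.

(** Induction over the coordinates: the midpoint inequality splits off one axis
    at the price of doubling the radius, hence the bound is proved for all
    radii at once, and on an axis convexity bounds [f] by two endpoint values. *)
Lemma convex_fun_bounded_above f (r : R) : convex_fun f ->
  exists M : R, forall x, `|x| <= r -> f x <= M.
Proof.
move=> cf.
suff H (s : seq 'I_n) : forall r : R, exists M, forall x, `|x| <= r ->
    f (\sum_(i <- s) x i 0 *: delta_mx i 0) <= M.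
  have [M HM] := H (index_enum 'I_n) r; exists M => x xr.
  have -> : x = \sum_i x i 0 *: delta_mx i 0.
    rewrite [LHS]matrix_sum_delta; apply: eq_bigr => i _.
    by rewrite big_ord1.
  exact: HM.
elim: s => [|i s IH] {}r; first by exists (f 0) => x _; rewrite big_nil.
have [M HM] := IH (2 * r).
exists (2^-1 * (Num.max (f ((2 * r) *: delta_mx i 0))
                        (f (- (2 * r) *: delta_mx i 0)) + M)) => x xr.
rewrite big_cons; apply: le_trans (convex_fun_midpoint _ _ cf) _.
rewrite ler_pM2l ?invr_gt0 // lerD //.
  rewrite scalerA; apply: convex_fun_axis => //.
  by rewrite normrM ger0_norm // ler_pM2l // (le_trans (coord_le_norm _ _)).
rewrite scaler_sumr.
have := HM (2 *: x); rewrite mx_normZ ger0_norm // ler_pM2l // => /(_ xr).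
by under eq_bigr do rewrite mxE -scalerA.
Qed.

(** A lower bound follows from the upper bound at the reflected point, since
    [f 0] is at most the mean of [f x] and [f (- x)]. *)
Lemma convex_fun_bounded f (r : R) : convex_fun f ->
  exists M : R, forall x, `|x| <= r -> `|f x| <= M.
Proof.
move=> cf; have [M HM] := convex_fun_bounded_above r cf.
exists (M + 2 * `|f 0|) => x xr.
have h1 := HM _ xr; have h2 : f (- x) <= M by apply: HM; rewrite normrN.
have h3 : f 0 <= 2^-1 * (f x + f (- x)).
  have := convex_fun_midpoint (2^-1 *: x) (- (2^-1 *: x)) cf.
  by rewrite addrN scalerN scalerA divff ?pnatr_eq0 // scale1r.
rewrite ler_norml.
have := ler_norm (f 0); have := ler_norm (- f 0); rewrite normrN => a b.
by apply/andP; split; lra.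
Qed.

(** Prolong the segment from [v] to [x] beyond [x] by the length [r]; the
    endpoint [u] stays in the ball of radius [2 r], where [f] is bounded.
    Convexity between [u] and [v] then bounds the slope from [v] to [x]. *)
Lemma convex_fun_lipschitz f (r : R) : convex_fun f -> 0 < r ->
  exists2 C : R, 0 < C &
    forall x v, `|x| <= r -> `|v| <= r -> f x - f v <= C * `|x - v|.
Proof.
move=> cf r0; have [M HM] := convex_fun_bounded (2 * r) cf.
have M0 : 0 <= M by apply: le_trans (HM 0 _); rewrite ?normr0 //; lra.
exists (2 * M / r + 1); first by rewrite ltr_wpDl // divr_ge0 //; lra.
move=> x v xr vr.
have [->|xv] := eqVneq x v; first by rewrite !subrr normr0 mulr0.
have d0 : 0 < `|x - v| by rewrite normr_gt0 subr_eq0.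
set d := `|x - v| in d0 *.
pose u := x + (r / d) *: (x - v).
have ur : `|u| <= 2 * r.
  apply: (le_trans (ler_normD _ _)); rewrite mx_normZ -/d.
  by rewrite ger0_norm ?divr_ge0 ?(ltW r0) ?(ltW d0) // divfK ?gt_eqF //; lra.
have vr2 : `|v| <= 2 * r by lra.
have t0 : 0 <= d / (d + r) by rewrite divr_ge0 //; lra.
have t1 : d / (d + r) <= 1 by rewrite ler_pdivrMr; lra.
have dr : d + r != 0 by rewrite gt_eqF // addr_gt0.
have := convex_funE u v cf t0 t1.
rewrite (_ : _ + _ = x); last first.
  apply/colP => i; rewrite !mxE; field.
  by rewrite dr gt_eqF.
have := HM _ ur; have := HM _ vr2; rewrite !ler_norml => /andP[v1 v2] /andP[u1 u2].
set t := d / (d + r) in t0 t1 *; move=> h.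
have td : t <= d / r by rewrite ler_pM2l // lef_pV2 ?posrE; lra.
have : t * (f u - f v) <= t * (2 * M) by rewrite ler_wpM2l //; lra.
have : t * (2 * M) <= d / r * (2 * M) by rewrite ler_wpM2r //; lra.
have -> : (2 * M / r + 1) * d = d / r * (2 * M) + d by field; rewrite gt_eqF.
nra.
Qed.

End ConvexLipschitz.

(** * Saddle points of the Lagrangian *)

(** The form in which optimality conditions are used: dividing a first-order
    expansion by the step [t] and letting [t] tend to 0. *)
Lemma first_order_ge0 (R : realFieldType) (a b : R) :
  (forall t, 0 < t -> t <= 1 -> 0 <= a + t * b) -> 0 <= a.
Proof.
move=> H; rewrite leNgt; apply/negP => a0.
have b0 := normr_ge0 b; have bb := ler_norm b.
have den : 0 < `|b| - a + 1 by lra.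
have t0 : 0 < - a / (`|b| - a + 1) by rewrite divr_gt0 //; lra.
have t1 : - a / (`|b| - a + 1) <= 1 by rewrite ler_pdivrMr //; lra.
have := H _ t0 t1.
have tE : - a / (`|b| - a + 1) * (`|b| - a + 1) = - a by rewrite divfK ?gt_eqF.
set t := - a / _ in t0 t1 tE *; nra.
Qed.

(** [b] may be infinite, as the dual value is before its finiteness is known. *)
Lemma fin_sube_le0 (R : realDomainType) (a : R) (b : \bar R) :
  (a%:E - b <= 0)%E = (a%:E <= b)%E.
Proof.
case: b => [b| |] /=; last by rewrite leeNy_eq.
  by rewrite -EFinB !lee_fin subr_le0.
by rewrite leNye leey.
Qed.

Section Saddle.
Context {R : realType} {n m : nat}.
Variables (f : 'cV[R]_n -> R) (g : 'I_m -> 'cV[R]_n -> R).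
Implicit Types (x : 'cV[R]_n) (y : 'cV[R]_m).

(** The Lagrangian without the indicator of the orthant, hence finite; it agrees
    with [lagrangian] when [y] is nonnegative. *)
Definition lag x y : R := f x + dotv y (Gmap g x).

Lemma nonneg_conv (t : R) y1 y2 : 0 <= t -> t <= 1 ->
  nonneg_orthant y1 -> nonneg_orthant y2 ->
  nonneg_orthant (t *: y1 + (1 - t) *: y2).
Proof.
by move=> t0 t1 h1 h2 j; rewrite !mxE addr_ge0 // mulr_ge0 ?h1 ?h2 ?subr_ge0.
Qed.

Lemma lag_convex (t : R) x1 x2 y :
  convex_fun f -> (forall j, convex_fun (g j)) ->
  0 <= t -> t <= 1 -> nonneg_orthant y ->
  lag (t *: x1 + (1 - t) *: x2) y <= t * lag x1 y + (1 - t) * lag x2 y.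
Proof.
move=> cf cg t0 t1 y0.
have hf := convex_funE x1 x2 cf t0 t1.
suff : dotv y (Gmap g (t *: x1 + (1 - t) *: x2))
    <= t * dotv y (Gmap g x1) + (1 - t) * dotv y (Gmap g x2) by rewrite /lag; lra.
rewrite !dotvE !mulr_sumr -big_split /=; apply: ler_sum => j _.
rewrite !mxE; have := convex_funE x1 x2 (cg j) t0 t1; have := y0 j; nra.
Qed.

Lemma lag_affine (t : R) x y1 y2 :
  lag x (t *: y1 + (1 - t) *: y2) = t * lag x y1 + (1 - t) * lag x y2.
Proof. by rewrite /lag !dotv_lin; ring. Qed.

(** A zero duality gap and feasibility force complementary slackness: the dual
    value is at most [L x y <= f x], so with no gap all three agree. *)
Lemma sol_set_saddle (z : 'cV[R]_(n + m)) : sol_set f g z ->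
  nonneg_orthant (dsubmx z) /\
  forall x y, nonneg_orthant y -> lag (usubmx z) y <= lag x (dsubmx z).
Proof.
move=> [h g0 y0]; split=> // x y hy.
have le0 y' : nonneg_orthant y' -> dotv y' (Gmap g (usubmx z)) <= 0.
  move=> y'0; rewrite dotvE sumr_le0 // => j _.
  by rewrite mxE mulr_ge0_le0 ?y'0.
have H x' : f (usubmx z) <= lag x' (dsubmx z).
  rewrite -lee_fin; apply: (@le_trans _ _ (dual_fun f g (dsubmx z))).
    by rewrite -fin_sube_le0.
  by rewrite /dual_fun; apply: ereal_inf_lbound; exists x'.
by apply: le_trans (H x); rewrite /lag gerDl le0.
Qed.

(** Testing the saddle inequality with [y = 0] gives the duality gap; testing it
    with large multiples of a basis vector gives feasibility. *)
Lemma saddle_sol_set (z : 'cV[R]_(n + m)) : nonneg_orthant (dsubmx z) ->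
  (forall x y, nonneg_orthant y -> lag (usubmx z) y <= lag x (dsubmx z)) ->
  sol_set f g z.
Proof.
move=> y0 H.
have o0 : nonneg_orthant (0 : 'cV[R]_m) by move=> j; rewrite mxE.
have fle x : f (usubmx z) <= lag x (dsubmx z).
  by have := H x 0 o0; rewrite /lag dotv0l addr0.
split => //.
  rewrite /= fin_sube_le0 /dual_fun.
  by apply: le_ereal_inf_tmp => _ [x _ <-]; rewrite lee_fin; exact: fle.
move=> j; rewrite leNgt; apply/negP => gj.
set K := dotv (dsubmx z) (Gmap g (usubmx z)).
have K0 : 0 <= K by have := fle (usubmx z); rewrite /lag lerDl.
(* This multiple makes the left-hand side exceed [K] by [g j (usubmx z)]. *)
have /(H (usubmx z)) :
    nonneg_orthant ((K / g j (usubmx z) + 1) *: delta_mx j 0 : 'cV[R]_m).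
  move=> i; rewrite !mxE mulr_ge0 //.
  by rewrite addr_ge0 // divr_ge0 // ltW.
rewrite /lag dotvZl -/K lerD2l dotvE (bigD1 j) //= big1 => [|i ij]; last first.
  by rewrite !mxE (negPf ij) mul0r.
rewrite !mxE !eqxx mul1r addr0 mulrDl divfK ?gt_eqF // mul1r.
by rewrite gerDl leNgt gj.
Qed.

End Saddle.

(** * One proximal step *)

Section ProximalStep.
Context {R : realType} {n m : nat}.
Variables (f : 'cV[R]_n -> R) (g : 'I_m -> 'cV[R]_n -> R).
Hypotheses (f_convex : convex_fun f) (g_convex : forall j, convex_fun (g j)).
Variables (eta : R) (eta_gt0 : 0 < eta).
Implicit Types (x : 'cV[R]_n) (y : 'cV[R]_m) (z : 'cV[R]_(n + m)).

Let c : R := (2 * eta)^-1.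
Let c_gt0 : 0 < c. Proof. by rewrite invr_gt0 mulr_gt0. Qed.

Lemma ppm_objectiveE z x y : ppm_objective f g eta z x y =
  lag f g x y + c * dotv (x - usubmx z) (x - usubmx z)
              - c * dotv (y - dsubmx z) (y - dsubmx z).
Proof. by rewrite /ppm_objective !norm2_sqr. Qed.

Variables (z zp : 'cV[R]_(n + m)).
Hypothesis step :
  is_argminmax nonneg_orthant (ppm_objective f g eta z) (usubmx zp) (dsubmx zp).
Local Notation phi := (ppm_objective f g eta z).
Local Notation xp := (usubmx zp).
Local Notation yp := (dsubmx zp).

Lemma step_nonneg : nonneg_orthant yp.
Proof. by case: step => _ []. Qed.

(** Strong concavity of [phi xp] improves maximality by a quadratic term. *)
Lemma step_dual y : nonneg_orthant y ->
  phi xp y + c * dotv (y - yp) (y - yp) <= phi xp yp.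
Proof.
move=> y0; have [_ [yp0 ymax]] := step.
rewrite -subr_ge0.
apply: (@first_order_ge0 _ _ (c * dotv (y - yp) (y - yp))) => t t0 t1.
have := ymax _ (nonneg_conv (ltW t0) t1 y0 yp0).
rewrite !ppm_objectiveE lag_affine !dotv_lin.
rewrite (dotvC y yp) (dotvC (dsubmx z)) (dotvC (dsubmx z) yp) => h.
rewrite -(pmulr_rge0 _ t0); move: h.
rewrite -subr_ge0; congr (0 <= _); ring.
Qed.

(** Since [xp] minimises the inner supremum, the value [phi xp yp] is nearly
    attained at every [x], and this does not need an inner maximum to exist
    there. *)
Lemma step_almost_attained x (e : R) : 0 < e ->
  exists2 y, nonneg_orthant y & phi xp yp - e < phi x y.
Proof.
move=> e0; have [xmin [yp0 _]] := step.
have : ((phi xp yp - e)%:E < ereal_sup [set (phi x y)%:E | y in nonneg_orthant])%E.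
  apply: lt_le_trans (xmin x).
  apply: (@lt_le_trans _ _ (phi xp yp)%:E); first by rewrite lte_fin; lra.
  by apply: ereal_sup_ubound; exists yp.
by move=> /ereal_sup_gt[_ [y y0 <-]]; rewrite lte_fin => ?; exists y.
Qed.

(** The Danskin-type condition.  Choose [y] for which [phi], at the point at
    fraction [t] of the segment from [xp] to [x], exceeds [phi xp yp - t^2].
    Convexity in the first argument bounds [phi] there by its values at [x] and
    [xp]; the value at [xp] loses [c |y - yp|^2] by [step_dual], and this absorbs
    the term linear in [t (y - yp)] that arises from [phi x y - phi x yp].  What
    remains is of order [t], with an error of order [t^2]. *)
Lemma step_primal x :
  phi xp yp + c * dotv (x - xp) (x - xp) <= phi x yp.
Proof.
have yp0 := step_nonneg.
(* [b] is the gradient of [phi x] at [yp]. *)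
pose b := Gmap g x - (2 * c) *: (yp - dsubmx z).
rewrite -subr_ge0.
apply: (@first_order_ge0 _ _
  (c * dotv (x - xp) (x - xp) + 1 + (4 * c)^-1 * dotv b b)) => t t0 t1.
have [y y0 hy] := step_almost_attained (t *: x + (1 - t) *: xp) (exprn_gt0 2 t0).
have h1 : phi (t *: x + (1 - t) *: xp) y <=
    t * phi x y + (1 - t) * phi xp y - t * (1 - t) * c * dotv (x - xp) (x - xp).
  have := lag_convex x xp f_convex g_convex (ltW t0) t1 y0.
  rewrite !ppm_objectiveE !dotv_lin.
  rewrite (dotvC x xp) (dotvC (usubmx z)) (dotvC (usubmx z) xp) => h.
  rewrite -subr_ge0 in h; rewrite -subr_ge0; move: h; congr (0 <= _); ring.
have h2 := step_dual y0.
have h3 : phi x y = phi x yp + dotv (y - yp) b - c * dotv (y - yp) (y - yp).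
  rewrite !ppm_objectiveE /lag /b !dotv_lin.
  by rewrite (dotvC y yp) (dotvC (dsubmx z)) (dotvC (dsubmx z) yp); ring.
have h4 : t * dotv (y - yp) b <=
    c * dotv (y - yp) (y - yp) + t ^+ 2 * ((4 * c)^-1 * dotv b b).
  (* Young's inequality: complete the square. *)
  have := dotv_ge0 ((y - yp) - (t / (2 * c)) *: b).
  move: (y - yp) b {h3} => d b; rewrite !dotv_lin (dotvC b d).
  rewrite -(pmulr_rge0 _ c_gt0) => sq; rewrite -subr_ge0; move: sq.
  congr (0 <= _).
  by rewrite /c; field; rewrite gt_eqF.
rewrite -(pmulr_rge0 _ t0); move: h1 h2 h3 h4 hy.
set D := dotv (y - yp) (y - yp); set X := dotv (x - xp) (x - xp).
set B := _ * dotv b b; set e := dotv (y - yp) b.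
move=> h1 h2 h3; rewrite h3 in h1.
have : (1 - t) * (phi xp y + c * D) <= (1 - t) * phi xp yp.
  by rewrite ler_wpM2l // subr_ge0.
nra.
Qed.

(** The basic estimate of the proximal point method: the sum of [step_primal]
    and [step_dual], in which the regularised values at [(xp, yp)] cancel. *)
Lemma prox_inequality w : nonneg_orthant (dsubmx w) ->
  lag f g xp (dsubmx w) - lag f g (usubmx w) yp
  + c * (dotv (zp - z) (zp - z) + dotv (w - zp) (w - zp) - dotv (w - z) (w - z))
  <= 0.
Proof.
move=> w0; have := step_dual w0; have := step_primal (usubmx w).
rewrite !ppm_objectiveE !dotv_block !linearB /=; lra.
Qed.

(** Expanding the squares in [step_primal] and [step_dual] leaves the linear
    terms of the two subgradient inequalities; off the orthant the dual one
    holds because its right-hand side is infinite. *)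
Lemma step_subgradient : saddle_subdiff f g zp (eta^-1 *: (z - zp)).
Proof.
have yp0 := step_nonneg.
have ind0 y : nonneg_orthant y -> indicator_nonneg y = 0%E.
  by move=> y0; rewrite /indicator_nonneg mem_set.
have lagE x y : nonneg_orthant y -> lagrangian f g x y = (lag f g x y)%:E.
  by move=> y0; rewrite /lagrangian ind0 // sube0.
have etaE : eta^-1 = 2 * c by rewrite /c; field; rewrite gt_eqF.
split; (split; first by rewrite lagE).
  move=> x; rewrite !lagE // -EFinD lee_fin linearZ linearB etaE /=.
  have := step_primal x; rewrite !ppm_objectiveE.
  rewrite !dotv_lin ?(dotvC (usubmx z) xp) ?(dotvC (usubmx z) x) ?(dotvC x xp); lra.
move=> y; have [y0|ny0] := pselect (nonneg_orthant y); last first.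
  by rewrite {2}/lagrangian /indicator_nonneg memNset //= leey.
rewrite !lagE // -!EFinN -EFinD lee_fin linearZ linearB etaE /=.
have := step_dual y0; rewrite !ppm_objectiveE.
rewrite !dotv_lin ?(dotvC (dsubmx z) yp) ?(dotvC (dsubmx z) y) ?(dotvC y yp); lra.
Qed.

(** Completing the square in [y] turns [phi xp] into a negative multiple of the
    squared distance to [dsubmx z + eta *: Gmap g xp], up to a constant. *)
Lemma step_dual_proj :
  is_proj nonneg_orthant (dsubmx z + eta *: Gmap g xp) yp.
Proof.
split=> [|y y0]; first exact: step_nonneg.
have [_ [_ /(_ _ y0)]] := step; rewrite !ppm_objectiveE /lag => h.
have etac : eta * c = 2^-1 by rewrite /c; field; rewrite gt_eqF.
rewrite ler_wsqrtr //; move: h; rewrite -subr_ge0 -(pmulr_rge0 _ eta_gt0).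
rewrite -[X in _ -> is_true X]subr_ge0 -[X in _ -> is_true X](@pmulr_rge0 _ 2^-1) //.
rewrite -etac !dotv_lin.
rewrite (dotvC (Gmap _ _) (dsubmx z)) (dotvC (Gmap _ _) y) (dotvC (Gmap _ _) yp).
rewrite (dotvC (dsubmx z) y) (dotvC (dsubmx z) yp).
have -> : eta = (2 * c)^-1 by rewrite /c; field; rewrite gt_eqF.
congr (0 <= _); field.
by rewrite gt_eqF.
Qed.

End ProximalStep.

(** * Limits of vectors *)

(** Convergence of vectors is expressed by coordinates, as this is the form in
    which ultrafilter limits are produced. *)
Lemma cvg_dotv (R : realType) n T (U : set_system T) {FU : Filter U}
    (u v : T -> 'cV[R]_n) (a b : 'cV[R]_n) :
  (forall i, u k i 0 @[k --> U] --> a i 0) ->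
  (forall i, v k i 0 @[k --> U] --> b i 0) ->
  dotv (u k) (v k) @[k --> U] --> dotv a b.
Proof.
move=> ua vb; rewrite dotvE; under eq_fun do rewrite dotvE.
by apply: cvg_big => [|i _]; [exact: add_continuous|exact: cvgM].
Qed.

Lemma cvg_norm2_0 (R : realType) n T (U : set_system T) {FU : Filter U}
    (u : T -> 'cV[R]_n) :
  dotv (u k) (u k) @[k --> U] --> (0 : R) -> norm2 (u k) @[k --> U] --> (0 : R).
Proof.
move=> u0; rewrite -(sqrtr0 R).
exact: (@continuous_cvg _ _ _ _ _ _ (@Num.sqrt R) _ (@sqrt_continuous R 0)).
Qed.

Lemma cvg_of_dist_le (R : realType) T (U : set_system T) {FU : Filter U}
    (h : T -> R) (e : T -> R) (l C : R) :
  (forall k, `|h k - l| <= C * e k) -> e @ U --> (0 : R) -> h @ U --> l.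
Proof.
move=> He e0.
have Ce0 : C * e k @[k --> U] --> (0 : R).
  by rewrite -(mulr0 C); apply: cvgM => //; exact: cvg_cst.
apply/subr_cvg0; apply/norm_cvg0P.
apply: (@squeeze_cvgr _ _ _ _ (cst 0) (fun k => C * e k)) => //.
- by near=> k; rewrite normr_ge0 /=; apply: He.
- exact: cvg_cst.
Unshelve. all: by end_near. Qed.

Lemma ultra_fmap T T' (h : T -> T') (U : set_system T) :
  UltraFilter U -> UltraFilter (h @ U).
Proof.
move=> UU; split; first exact: _.
move=> G GG UG; apply/seteqP; split=> // A GA.
have [//|UA] := in_ultra_setVsetC (h @^-1` A) UU.
have /UG GAc : (h @ U) (~` A) by [].
have /filter_ex[x []//] : G (A `&` ~` A) by exact: filterI.
Qed.

(** Each coordinate lies in a compact interval, so it converges along any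
    ultrafilter; one ultrafilter serves all coordinates and no subsequences have
    to be extracted. *)
Lemma bounded_cluster (R : realType) n (u : nat -> 'cV[R]_n) (B : R) :
  (forall k, norm2 (u k) <= B) ->
  exists (U : set_system nat) (ubar : 'cV[R]_n),
    [/\ UltraFilter U, \oo `<=` U
      & forall i, u k i 0 @[k --> U] --> ubar i 0].
Proof.
move=> uB; have [U [UU ooU]] := @ultraFilterLemma _ \oo _.
suff /choice[l lP] : forall i, exists l : R, u k i 0 @[k --> U] --> l.
  exists U, (\col_i l i); split => // i; rewrite mxE; exact: lP.
move=> i; have := @segment_compact R (- B) B; rewrite compact_ultra.
move=> /(_ (u k i 0 @[k --> U])) [].
- exact: ultra_fmap.
- apply: (@filterE _ U) => k; rewrite /= in_itv /= -ler_norml.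
  exact: le_trans (coord_le_norm2 _ _) (uB k).
- by move=> l [_ ul]; exists l.
Qed.

Lemma cvg_convex_fun (R : realType) n (f : 'cV[R]_n -> R) T (U : set_system T)
    {FU : Filter U} (u : T -> 'cV[R]_n) (a : 'cV[R]_n) (B : R) :
  convex_fun f -> (forall k, norm2 (u k) <= B) ->
  (forall i, u k i 0 @[k --> U] --> a i 0) -> f (u k) @[k --> U] --> f a.
Proof.
move=> cf uB ua.
have r0 : 0 < `|B| + `|a| + 1 by rewrite ltr_wpDl // addr_ge0.
have [C C0 HC] := convex_fun_lipschitz cf r0.
have ar : `|a| <= `|B| + `|a| + 1 by have := normr_ge0 B; lra.
have ur k : `|u k| <= `|B| + `|a| + 1.
  have := le_trans (norm_le_norm2 (u k)) (uB k).
  by have := ler_norm B; have := normr_ge0 a; lra.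
apply: (@cvg_of_dist_le _ _ _ _ _ (fun k => norm2 (u k - a)) _ C).
  move=> k; apply: (@le_trans _ _ (C * `|u k - a|)); last first.
    by rewrite ler_pM2l // norm_le_norm2.
  rewrite ler_norml; have := HC _ _ (ur k) ar; have := HC _ _ ar (ur k).
  by rewrite (distrC a); move=> h1 h2; apply/andP; split; lra.
apply: cvg_norm2_0; rewrite -(dotv0l (0 : 'cV[R]_n)).
have da i : (u k - a) i 0 @[k --> U] --> (0 : 'cV[R]_n) i 0.
  rewrite mxE; under eq_fun do rewrite !mxE.
  exact/subr_cvg0/ua.
exact: cvg_dotv.
Qed.

(** * The sequence of iterates *)

Section Iterates.
Context {R : realType} {n m : nat}.
Variables (f : 'cV[R]_n -> R) (g : 'I_m -> 'cV[R]_n -> R).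
Hypotheses (f_convex : convex_fun f) (g_convex : forall j, convex_fun (g j)).
Variables (eta : R) (eta_gt0 : 0 < eta) (z : nat -> 'cV[R]_(n + m)).
Hypothesis z_ppm : ppm_iterates f g eta z.
Let c : R := (2 * eta)^-1.
Let c_gt0 : 0 < c. Proof. by rewrite invr_gt0 mulr_gt0. Qed.
Local Notation sq u := (dotv u u).

(** The saddle inequality of [w] makes the Lagrangian terms of the proximal
    inequality nonnegative. *)
Lemma fejer w k : sol_set f g w ->
  sq (z k.+1 - z k) + sq (z k.+1 - w) <= sq (z k - w).
Proof.
move=> /sol_set_saddle[w0 wsad].
have := prox_inequality f_convex g_convex eta_gt0 (z_ppm k) w0.
have := wsad (usubmx (z k.+1)) _ (step_nonneg (z_ppm k)).
rewrite -/c => h1 h2.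
rewrite -(opprB w (z k.+1)) -(opprB w (z k)) !dotvNl !dotvNr !opprK.
rewrite -subr_le0 -(pmulr_rle0 _ c_gt0); lra.
Qed.

Lemma fejer_le w k l : sol_set f g w -> (k <= l)%N ->
  sq (z l - w) <= sq (z k - w).
Proof.
move=> wS; elim: l => [|l IH]; first by rewrite leqn0 => /eqP ->.
rewrite leq_eqVlt => /predU1P[->//|]; rewrite ltnS => /IH; apply: le_trans.
by have := fejer l wS; have := dotv_ge0 (z l.+1 - z l); lra.
Qed.

(** Each of two consecutive steps is compared with the endpoint of the other.  The
    Lagrangian terms cancel in the sum, and the parallelogram identity leaves
    the claim. *)
Lemma step_nonincreasing k : sq (z k.+2 - z k.+1) <= sq (z k.+1 - z k).
Proof.
have := prox_inequality f_convex g_convex eta_gt0 (z_ppm k)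
          (step_nonneg (z_ppm k.+1)).
have := prox_inequality f_convex g_convex eta_gt0 (z_ppm k.+1)
          (step_nonneg (z_ppm k)).
rewrite -/c subrr dotv0l subr0 => h1 h2.
have par := dotv_ge0 ((z k.+2 - z k.+1) - (z k.+1 - z k)).
have e1 : sq (z k.+2 - z k) = 2 * sq (z k.+2 - z k.+1) + 2 * sq (z k.+1 - z k)
    - sq ((z k.+2 - z k.+1) - (z k.+1 - z k)).
  rewrite !dotv_lin (dotvC (z k.+2) (z k.+1)) (dotvC (z k.+2) (z k)).
  by rewrite (dotvC (z k.+1) (z k)); ring.
have e2 : sq (z k.+1 - z k.+2) = sq (z k.+2 - z k.+1).
  by rewrite -opprB dotvNl dotvNr opprK.
rewrite -subr_le0 -(pmulr_rle0 _ c_gt0); rewrite e1 e2 in h1 h2.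
have := mulr_ge0 (ltW c_gt0) par; lra.
Qed.

(** Summing [fejer] telescopes, and each of the [k.+1] steps is at least as long
    as the last one. *)
Lemma step_rate w k : sol_set f g w ->
  k.+1%:R * sq (z k.+1 - z k) <= sq (z 0%N - w).
Proof.
move=> wS.
suff : k.+1%:R * sq (z k.+1 - z k) + sq (z k.+1 - w) <= sq (z 0%N - w).
  by have := dotv_ge0 (z k.+1 - w); lra.
elim: k => [|k IH]; first by rewrite mul1r; exact: fejer.
apply: le_trans IH; have := fejer k.+1 wS.
have : k.+1%:R * sq (z k.+2 - z k.+1) <= k.+1%:R * sq (z k.+1 - z k).
  by rewrite ler_wpM2l // step_nonincreasing.
by rewrite -[in k.+2%:R]natr1; lra.
Qed.

Hypothesis sol_nonempty : sol_set f g !=set0.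

Lemma cvg_step0 : sq (z k.+1 - z k) @[k --> \oo] --> (0 : R).
Proof.
have [w wS] := sol_nonempty.
apply: (@cvg_of_dist_le _ _ _ _ _ harmonic _ (sq (z 0%N - w))); last exact: cvg_harmonic.
move=> k; rewrite subr0 ger0_norm ?dotv_ge0 // /harmonic /=.
by rewrite ler_pdivlMr // mulrC step_rate.
Qed.

Lemma iterates_bounded : exists B, forall k, norm2 (z k) <= B.
Proof.
have [w wS] := sol_nonempty.
exists (Num.sqrt (2 * sq (z 0%N - w) + 2 * sq w)) => k.
rewrite ler_wsqrtr //; have := fejer_le wS (leq0n k).
(* Parallelogram law: [|z k|^2 + |z k - 2 w|^2 = 2 |z k - w|^2 + 2 |w|^2]. *)
have := dotv_ge0 (z k - 2 *: w).
rewrite !dotv_lin !(dotvC w (z k)) (dotvC w (z 0%N)); lra.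
Qed.

(** With [a = z+ - z] and [b = w - z+], the quadratic terms of the proximal
    inequality collapse to [- 2 c <a, b>], which vanishes in the limit because
    [a] does and [b] converges.  What remains at the limit is the saddle
    inequality. *)
Lemma iterates_cluster : exists (U : set_system nat) (zbar : 'cV[R]_(n + m)),
  [/\ ProperFilter U, sol_set f g zbar &
      sq (z k.+1 - zbar) @[k --> U] --> (0 : R)].
Proof.
have [B zB] := iterates_bounded.
have [U [zbar [UU ooU zU]]] := bounded_cluster (fun k => zB k.+1).
exists U, zbar; split; first exact: _.
  have xU i : usubmx (z k.+1) i 0 @[k --> U] --> usubmx zbar i 0.
    by rewrite mxE; under eq_fun do rewrite mxE; exact: zU.
  have yU i : dsubmx (z k.+1) i 0 @[k --> U] --> dsubmx zbar i 0.
    by rewrite mxE; under eq_fun do rewrite mxE; exact: zU.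
  have xB k : norm2 (usubmx (z k.+1)) <= B.
    exact: le_trans (norm2_usubmx _) (zB _).
  have fU := cvg_convex_fun f_convex xB xU.
  have gU j := cvg_convex_fun (g_convex j) xB xU.
  apply: saddle_sol_set => [j|x y y0].
    by apply: (cvgr_to_ge (yU j)); apply: nearW => k; exact: (step_nonneg (z_ppm k)).
  pose w := col_mx x y.
  have stepU i : (z k.+1 - z k) i 0 @[k --> U] --> (0 : 'cV[R]_(n + m)) i 0.
    have step0 : (z k.+1 - z k) i 0 @[k --> \oo] --> (0 : R).
      apply: (@cvg_of_dist_le _ _ _ _ _ (fun k => norm2 (z k.+1 - z k)) _ 1).
        by move=> k; rewrite subr0 mul1r coord_le_norm2.
      by apply: cvg_norm2_0; exact: cvg_step0.
    by rewrite mxE => A A0; apply: ooU; exact: step0.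
  have gapU i : (w - z k.+1) i 0 @[k --> U] --> (w - zbar) i 0.
    rewrite !mxE; under eq_fun do rewrite !mxE.
    by apply: cvgB; [exact: cvg_cst|exact: zU].
  have lhsU : lag f g (usubmx (z k.+1)) y - lag f g x (dsubmx (z k.+1))
      @[k --> U] --> lag f g (usubmx zbar) y - lag f g x (dsubmx zbar).
    apply: cvgB; apply: cvgD => //.
    - exact: fU.
    - apply: (cvg_dotv (u := fun=> y) (v := fun k => Gmap g (usubmx (z k.+1)))) => i.
        exact: cvg_cst.
      by rewrite mxE; under eq_fun do rewrite mxE; exact: gU.
    - exact: cvg_cst.
    - apply: (cvg_dotv (u := fun k => dsubmx (z k.+1)) (v := fun=> Gmap g x)) => i.
        exact: yU.
      exact: cvg_cst.
  have rhsU : 2 * c * dotv (z k.+1 - z k) (w - z k.+1) @[k --> U] --> (0 : R).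
    rewrite -(mulr0 (2 * c)) -(dotv0l (w - zbar)).
    by apply: cvgM; [exact: cvg_cst|exact: cvg_dotv].
  rewrite -subr_le0; apply: (ler_cvg_to lhsU rhsU); apply: nearW => k.
  have w0 : nonneg_orthant (dsubmx w) by rewrite col_mxKd.
  have := prox_inequality f_convex g_convex eta_gt0 (z_ppm k) w0.
  rewrite -/c col_mxKd col_mxKu.
  rewrite (_ : w - z k = (z k.+1 - z k) + (w - z k.+1)); last first.
    by rewrite [RHS]addrC addrA subrK.
  move: (z k.+1 - z k) (w - z k.+1) => a b.
  rewrite [dotv (a + b) _]dotvDl !(dotvDr a b) (dotvC b a); lra.
rewrite -(dotv0l (0 : 'cV[R]_(n + m))).
have dU i : (z k.+1 - zbar) i 0 @[k --> U] --> (0 : 'cV[R]_(n + m)) i 0.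
  by rewrite mxE; under eq_fun do rewrite !mxE; exact/subr_cvg0/zU.
exact: cvg_dotv.
Qed.

(** The distance to the cluster point is nonincreasing, so being small once
    makes it small from then on. *)
Lemma iterates_cvg : exists2 zstar, sol_set f g zstar &
  sq (z k - zstar) @[k --> \oo] --> (0 : R).
Proof.
have [U [zbar [UU zS zU]]] := iterates_cluster.
exists zbar => //; apply/cvgrPdist_lt => e e0.
have /cvgrPdist_lt/(_ e e0)/filter_ex[k] := zU.
rewrite sub0r normrN ger0_norm ?dotv_ge0 // => ke.
exists k.+1 => // l /= kl; rewrite sub0r normrN ger0_norm ?dotv_ge0 //.
exact: le_lt_trans (fejer_le zS kl) ke.
Qed.

End Iterates.

(** * Properties of the proximal point method *)

Lemma le_dist_div (R : realType) n (N : 'cV[R]_n -> R) z (Q : set 'cV[R]_n)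
    (a r : R) : 0 < r -> (forall q, Q q -> a * r <= N (z - q)) ->
  (a%:E <= 1%:E * dist N z Q * (r^-1)%:E)%E.
Proof.
move=> r0 H; rewrite mul1e lee_pdivlMr // -EFinM.
by apply: le_ereal_inf_tmp => _ [q Qq <-]; rewrite lee_fin; exact: H.
Qed.

Theorem proposition3p2 (R : realType) (n m : nat)
  (f : 'cV[R]_n -> R) (g : 'I_m -> 'cV[R]_n -> R)
  (f_convex : convex_fun f) (g_convex : forall j, convex_fun (g j))
  (sol_nonempty : sol_set f g !=set0)
  (eta : R) (eta_gt0 : 0 < eta)
  (z ztilde : nat -> 'cV[R]_(n + m))
  (z_ppm : ppm_iterates f g eta z)
  (ztildeE : forall k, ztilde k = z k) :
  let P : 'M[R]_(n + m) := eta^-1%:M in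
  let gamma : R := 1 in
  exists2 zstar : 'cV[R]_(n + m), sol_set f g zstar &
  [/\ [/\ (fun k => Num.max (normM P (z k - zstar)) (normM P (ztilde k - zstar)))
            @ \oo --> (0 : R),
          (exists2 etahat : R, 0 < etahat &
             forall k, is_proj nonneg_orthant
               (dsubmx (z k) + etahat *: Gmap g (usubmx (ztilde k.+1)))
               (dsubmx (z k.+1))) &
          (forall (t : R) (j : 'I_m), 0 < t ->
             exists Lx Ly : R, [/\ 0 < Lx, 0 < Ly &
               forall w w', ballM P t zstar w -> ballM P t zstar w' ->
                 g j (usubmx w) - g j (usubmx w') <= Lx * normM P (w - w') /\
                 `|dsubmx w j 0 - dsubmx w' j 0| <= Ly * normM P (w - w')])],
      (forall k, (1 <= k)%N ->
         (distM (invmx P) 0 (saddle_subdiff f g (z k))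
          <= gamma%:E * distM P (z 0%N) (sol_set f g) * (Num.sqrt k%:R)^-1%:E)%E) /\
      (exists2 tau : R, 0 < tau &
         forall k, (1 <= k)%N -> (dist2 (z k) (sol_set f g) <= tau%:E)%E) &
      (forall k, (1 <= k)%N ->
         ((Num.max (normM P (z k.+1 - z k)) (normM P (z k - ztilde k)))%:E
          <= gamma%:E * distM P (z 0%N) (sol_set f g) * (Num.sqrt k%:R)^-1%:E)%E) /\
      (forall zbar k, sol_set f g zbar ->
         normM P (zstar - zbar) <= normM P (z k - zbar))].
Proof.
move=> P gamma.
have ei0 : 0 < eta^-1 by rewrite invr_gt0.
pose s := Num.sqrt eta^-1; have s0 : 0 < s by rewrite sqrtr_gt0.
have normP u : normM P u = s * norm2 u by rewrite /P normM_scalar // ltW.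
have stepP k : normM P (z k.+2 - z k.+1) <= normM P (z k.+1 - z k).
  rewrite !normP ler_pM2l // ler_wsqrtr //.
  exact: (step_nonincreasing f_convex g_convex eta_gt0).
have rateP w k : sol_set f g w ->
    normM P (z k.+1 - z k) * Num.sqrt k.+1%:R <= normM P (z 0%N - w).
  move=> wS; rewrite !normP -mulrA ler_pM2l // -sqrtrM ?dotv_ge0 //.
  rewrite ler_wsqrtr // mulrC.
  exact: (step_rate f_convex g_convex eta_gt0).
have k_gt0 k : (1 <= k)%N -> 0 < Num.sqrt k%:R :> R.
  by move=> k1; rewrite sqrtr_gt0 ltr0n.
have [zs zsS zs_cvg] := iterates_cvg f_convex g_convex eta_gt0 z_ppm sol_nonempty.
exists zs => //; split; first split.
- under eq_fun do rewrite ztildeE maxxx normP.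
  rewrite -(mulr0 s); apply: cvgM; first exact: cvg_cst.
  exact: cvg_norm2_0.
- exists eta => // k; rewrite ztildeE.
  exact: (step_dual_proj eta_gt0 (z_ppm k)).
- move=> t j t0.
  have r0 : 0 < `|usubmx zs| + t / s by rewrite ltr_wpDl // divr_gt0.
  have [C C0 HC] := convex_fun_lipschitz (g_convex j) r0.
  have inr w : ballM P t zs w -> `|usubmx w| <= `|usubmx zs| + t / s.
    rewrite /ballM /= normP mulrC -ltr_pdivlMr // => wt.
    have -> : usubmx w = usubmx zs + usubmx (w - zs).
      by rewrite -linearD addrC subrK.
    apply: (le_trans (ler_normD _ _)); rewrite lerD2l.
    apply: (le_trans (norm_le_norm2 _)).
    exact: le_trans (norm2_usubmx _) (ltW wt).
  exists (C / s), s^-1; split; rewrite ?divr_gt0 ?invr_gt0 // => w w' wB w'B.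
  rewrite normP mulrA divfK ?gt_eqF // mulKf ?gt_eqF //; split.
    apply: (le_trans (HC _ _ (inr _ wB) (inr _ w'B))).
    rewrite ler_pM2l // -linearB; apply: (le_trans (norm_le_norm2 _)).
    exact: norm2_usubmx.
  have -> : dsubmx w j 0 - dsubmx w' j 0 = dsubmx (w - w') j 0 by rewrite !mxE.
  exact: le_trans (coord_le_norm2 _ _) (norm2_dsubmx _).
- split=> [[//|k] _|].
    rewrite /gamma.
    apply: (@le_trans _ _ (normM P (z k.+1 - z k))%:E).
      apply: ge_ereal_inf; exists (normM P (z k.+1 - z k))%:E => //.
      exists (eta^-1 *: (z k - z k.+1)).
        exact: (step_subgradient f_convex g_convex eta_gt0 (z_ppm k)).
      congr EFin; rewrite /P invmx_scalar invrK.
      rewrite !normM_scalar ?(ltW eta_gt0) ?(ltW ei0) //.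
      rewrite -!sqrtrM ?(ltW eta_gt0) ?(ltW ei0) //; congr Num.sqrt.
      rewrite sub0r -scalerN opprB dotvZl dotvZr.
      by field; rewrite gt_eqF.
    by apply: le_dist_div => [|q qS]; [exact: k_gt0|exact: rateP].
  exists (norm2 (z 0%N - zs) + 1); first by rewrite ltr_wpDl ?norm2_ge0.
  move=> k _; apply: ge_ereal_inf; exists (norm2 (z k - zs))%:E; first by exists zs.
  rewrite lee_fin; apply: (@le_trans _ _ (norm2 (z 0%N - zs))); last by lra.
  by rewrite ler_wsqrtr // (fejer_le f_convex g_convex eta_gt0).
- split=> [[//|k] _|w k wS].
    rewrite ztildeE subrr [normM P 0]normP.
    rewrite /norm2 dotv0l sqrtr0 mulr0 max_l; last first.
      by rewrite normP mulr_ge0 ?norm2_ge0 ?ltW.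
    apply: le_dist_div => [|q qS]; first exact: k_gt0.
    apply: le_trans (rateP q k qS); rewrite ler_pM2r ?k_gt0 //.
  rewrite !normP ler_pM2l // ler_wsqrtr //.
  have gapU i : (z l - w) i 0 @[l --> \oo] --> (zs - w) i 0.
    rewrite !mxE; under eq_fun do rewrite !mxE.
    apply: cvgB; last exact: cvg_cst.
    apply: (@cvg_of_dist_le _ _ _ _ (fun l => z l i 0) (fun l => norm2 (z l - zs)) _ 1).
      by move=> l; rewrite mul1r; have := coord_le_norm2 (z l - zs) i; rewrite !mxE.
    exact: cvg_norm2_0.
  apply: (cvgr_to_le (cvg_dotv gapU gapU)).
  exists k => // l /= kl.
  exact: (fejer_le f_convex g_convex eta_gt0).
Qed.
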